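(* Let $A \in \mathcal M_d(\mathbb R)$, let $\tau$ be a delay function such that $\inf_{s \in [0, t]} \tau(s) > 0$ for every $t \geq 0$ and such that the function $\sigma_1\colon \mathbb R_+ \to \mathbb R$, $\sigma_1(t) = t - \tau(t)$, is well-regulated, let $h$ be the largest delay function associated with $\tau$, and let $x_0 \in \mathsf G_0$. Then there exists a unique regulated solution $x \in G(\lvert -h(0), +\infty), \mathbb R^d)$ of $$x(t) = A x(t - \tau(t)), \qquad t \geq 0,$$ with initial condition $x_0$. In addition, $x_t \in \mathsf G_t$ for every $t \in \mathbb R_+$.
   Context: $\mathbb R_+ = [0, +\infty)$, $\mathbb R_+^\ast = (0, +\infty)$; $\mathcal M_d(\mathbb R)$ is the set of real $d \times d$ matrices, $d$ a positive integer. For $a \leq b$ in $\mathbb R \cup \{\pm\infty\}$, $\lvert a, b]$ denotes $[a, b]$ if $a > -\infty$ and $(a, b]$ if $a = -\infty$; $\lvert a, b)$ is defined similarly. Regulated functions: for a nonempty closed interval $K \subset \mathbb R$ (possibly unbounded), $f\colon K \to \mathbb R$ is \emph{regulated} if the (finite) lateral limit $f(t_0^+)$ exists at every $t_0 \in K$ which is not the right endpoint of $K$ and the (finite) lateral limit $f(t_0^-)$ exists at every $t_0 \in K$ which is not the left endpoint of $K$ (no boundedness is required). An $\mathbb R^d$-valued function is regulated if all its components are; $G(K, \mathbb R^d)$ is the set of such functions. $f\colon K \to \mathbb R$ is \emph{well-regulated} if it is regulated and: (i) for every $t_0 \in K$ which is not the right endpoint, there is $\varepsilon > 0$ with $(t_0,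 t_0 + \varepsilon) \subset K$ such that either $f(t) > f(t_0^+)$ for all $t \in (t_0, t_0 + \varepsilon)$, or $f(t) = f(t_0^+)$ for all such $t$, or $f(t) < f(t_0^+)$ for all such $t$; (ii) for every $t_0 \in K$ which is not the left endpoint, there is $\varepsilon > 0$ with $(t_0 - \varepsilon, t_0) \subset K$ such that either $f(t) > f(t_0^-)$ for all $t \in (t_0 - \varepsilon, t_0)$, or $f(t) = f(t_0^-)$ for all such $t$, or $f(t) < f(t_0^-)$ for all such $t$. A \emph{delay function} is any function $\tau\colon \mathbb R_+ \to \mathbb R_+^\ast$. Its \emph{largest delay function} is $h\colon \mathbb R_+ \to \mathbb R_+^\ast \cup \{+\infty\}$, $h(t) = t - \inf_{s \in [t, +\infty)} (s - \tau(s))$. A \emph{regulated solution} is a regulated function $x\colon \lvert -h(0), +\infty) \to \mathbb R^d$ such that $x(t) = A x(t - \tau(t))$ for every $t \in \mathbb R_+$; its \emph{initial condition} is its restriction to $\lvert -h(0), 0]$. For $t \in \mathbb R_+$, $\mathsf G_t = \{y \in G(\lvert -h(t), 0], \mathbb R^d) \mid y(0) = A y(-\tau(t))\}$, and $x_t\colon \lvert -h(t), 0] \to \mathbb R^d$ is defined by $x_t(s) = x(t + s)$. *)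

(* Defs.v *)
From HB Require Import structures.
From mathcomp Require Import all_boot all_order all_algebra.
From mathcomp Require Import all_classical all_reals all_analysis.

Set Implicit Arguments.
Unset Strict Implicit.
Unset Printing Implicit Defensive.

Import Order.TTheory GRing.Theory Num.Theory.
Import numFieldNormedType.Exports.

Local Open Scope classical_set_scope.
Local Open Scope ring_scope.

(* A function defined on a subset of R is represented by a total function on R
   whose values outside that subset are ignored; equality of two such functions
   is pointwise equality on the subset. *)

(* The intervals |a, b] and |a, b): a point of R never equals -oo, so the left
   end is closed when a is finite and open when a = -oo. *)
Definition bar_itv_c (R : realType) (a : \bar R) (b : R) : set R :=
  [set x | (a <= x%:E)%E /\ x <= b].

Definition bar_itv_o (R : realType) (a b : \bar R) : set R :=
  [set x | (a <= x%:E)%E /\ (x%:E < b)%E].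

(* In the definitions below K is meant to be a nonempty closed interval,
   possibly unbounded.  At t0 in K, having a point of K to the right of t0 means
   that t0 is not the right endpoint; a right neighborhood of t0 is then
   contained in K, so that the filter t0^'+ only sees values of f on K. *)
Definition has_right (R : realType) (K : set R) (t0 : R) : Prop :=
  exists2 s, K s & t0 < s.

Definition has_left (R : realType) (K : set R) (t0 : R) : Prop :=
  exists2 s, K s & s < t0.

Definition regulated (R : realType) (K : set R) (f : R -> R) : Prop :=
  forall t0, K t0 ->
    (has_right K t0 -> cvg (f t @[t --> t0^'+])) /\
    (has_left K t0 -> cvg (f t @[t --> t0^'-])).

Definition regulatedv (R : realType) (d : nat) (K : set R)
    (f : R -> 'cV[R]_d) : Prop :=
  forall i : 'I_d, regulated K (fun t => f t i 0).

Definition one_sided_on (R : realType) (f : R -> R) (l : R) (J : set R) : Prop :=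
  [\/ forall t, J t -> l < f t,
      forall t, J t -> f t = l
    | forall t, J t -> f t < l].

Definition well_regulated (R : realType) (K : set R) (f : R -> R) : Prop :=
  [/\ regulated K f,
      forall t0, K t0 -> has_right K t0 ->
        exists2 e : R, 0 < e & `]t0, (t0 + e)[ `<=` K /\
          one_sided_on f (lim (f t @[t --> t0^'+])) `]t0, (t0 + e)[
    & forall t0, K t0 -> has_left K t0 ->
        exists2 e : R, 0 < e & `](t0 - e), t0[ `<=` K /\
          one_sided_on f (lim (f t @[t --> t0^'-])) `](t0 - e), t0[].

Definition delay_function (R : realType) (tau : R -> R) : Prop :=
  forall t, 0 <= t -> 0 < tau t.

Definition largest_delay (R : realType) (tau : R -> R) (t : R) : \bar R :=
  (t%:E - ereal_inf [set (s - tau s)%:E | s in `[t, +oo[])%E.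

Definition regulated_solution (R : realType) (d : nat) (A : 'M[R]_d)
    (tau : R -> R) (x : R -> 'cV[R]_d) : Prop :=
  regulatedv (bar_itv_o (- largest_delay tau 0)%E +oo%E) x /\
  (forall t, 0 <= t -> x t = A *m x (t - tau t)).

Definition has_initial_condition (R : realType) (d : nat) (tau : R -> R)
    (x x0 : R -> 'cV[R]_d) : Prop :=
  forall t, bar_itv_c (- largest_delay tau 0)%E 0 t -> x t = x0 t.

(* The set G_t. *)
Definition GG (R : realType) (d : nat) (A : 'M[R]_d) (tau : R -> R) (t : R) :
    set (R -> 'cV[R]_d) :=
  [set y | regulatedv (bar_itv_c (- largest_delay tau t)%E 0) y /\
           y 0 = A *m y (- tau t)].

Definition history (R : realType) (d : nat) (x : R -> 'cV[R]_d) (t : R) :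
    R -> 'cV[R]_d :=
  fun s => x (t + s).

(* Main.v *)
(* On [0, T] the delay is bounded below by some delta > 0, so properties propagate
   from (-oo, t - delta] to t, starting from the negative half-line.  This gives
   existence, uniqueness and regularity.  For the last one, x(t) = A x(sigma_1(t))
   and sigma_1 approaches its lateral limit L at t0 from a single side (or is
   constant), so x(sigma_1(t)) converges to a lateral limit (or to the value) of
   x at the point L <= t0 - delta. *)

Require Import Defs.
From HB Require Import structures.
From mathcomp Require Import all_boot all_order all_algebra.
From mathcomp Require Import all_classical all_reals all_analysis.
From mathcomp Require Import lra.

Set Implicit Arguments.
Unset Strict Implicit.

Import Order.TTheory GRing.Theory Num.Theory.
Import numFieldNormedType.Exports.

Local Open Scope classical_set_scope.
Local Open Scope ring_scope.

(** Regularity at a single point, so that it can be propagated from earlier to later times by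
    induction. *)
Definition regulated_at (R : realType) (K : set R) (f : R -> R) (t0 : R) : Prop :=
  (has_right K t0 -> cvg (f t @[t --> t0^'+])) /\
  (has_left K t0 -> cvg (f t @[t --> t0^'-])).

(** * Induction along the delay and construction of the solution *)

Definition positive_on_bounded (R : realType) (tau : R -> R) : Prop :=
  forall T, exists2 delta, 0 < delta & forall s, 0 <= s <= T -> delta <= tau s.

Lemma inf_positive_on_bounded (R : realType) (tau : R -> R) :
  delay_function tau ->
  (forall t, 0 <= t -> 0 < inf [set tau s | s in `[0, t]]) ->
  positive_on_bounded tau.
Proof.
move=> htau hinf T; have [T0|T0] := leP 0 T; last first.
  by exists 1 => // s /andP[s0 sT]; lra.
exists (inf [set tau s | s in `[0, T]]); first exact: hinf.
move=> s sT; apply: ge_inf; last by exists s => //=; rewrite in_itv.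
(* A lower bound of the set is required for [inf] to lie below its elements; positivity of the delay
   provides 0. *)
exists 0 => _ [u /= + <-]; rewrite in_itv /= => /andP[u0 _].
exact/ltW/htau.
Qed.

(** With [delta] fixed for the times up to [t + 1], each step extends [P] from below [n * delta] to
    below [(n + 1) * delta], and finitely many steps reach [t]. The strict margin [t < T] leaves a
    right neighborhood of [t] where the same [delta] still bounds the delay, as limits from the
    right demand. *)
Lemma delay_ind (R : realType) (tau : R -> R) (P : R -> Prop) :
  positive_on_bounded tau ->
  (forall t, t < 0 -> P t) ->
  (forall T delta, 0 < delta -> (forall s, 0 <= s <= T -> delta <= tau s) ->
    forall t, 0 <= t < T -> (forall s, s <= t - delta -> P s) -> P t) ->
  forall t, P t.
Proof.
move=> htau P0 PS t; have [delta d0 hd] := htau (t + 1).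
have main n s : s < t + 1 -> s < n%:R * delta -> P s.
  elim: n s => [|n IHn] s st; first by rewrite mul0r; exact: P0.
  rewrite -natr1 mulrDl mul1r => sn.
  have [s0|s0] := ltP s 0; first exact: P0.
  apply: (PS _ _ d0 hd); first by rewrite s0.
  by move=> u us; apply: IHn; lra.
apply: (main (Num.truncn (t / delta)).+1); first lra.
by rewrite -ltr_pdivrMr // truncnS_gt.
Qed.

(** The fuel [n] bounds the number of unfoldings of the equation. The value 0 is a placeholder for
    exhausted fuel at a nonnegative time. *)
Fixpoint unroll (R : realType) (d : nat) (A : 'M[R]_d) (tau : R -> R)
    (x0 : R -> 'cV[R]_d) (n : nat) (t : R) : 'cV[R]_d :=
  if t < 0 then x0 t
  else if n is m.+1 then A *m unroll A tau x0 m (t - tau t) else 0.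

(** At each time [unroll] is eventually constant in the fuel, by [delay_ind]; the eventual values
    form [x], and the recursion becomes the equation. *)
Lemma delay_solution_exists (R : realType) (d : nat) (A : 'M[R]_d)
    (tau : R -> R) (x0 : R -> 'cV[R]_d) : positive_on_bounded tau ->
  exists x : R -> 'cV[R]_d, (forall t, t < 0 -> x t = x0 t) /\
    (forall t, 0 <= t -> x t = A *m x (t - tau t)).
Proof.
move=> htau; set u := unroll A tau x0.
have uS n t : 0 <= t -> u n.+1 t = A *m u n (t - tau t).
  by move=> t0; rewrite /u /= ltNge t0.
have u0 n t : t < 0 -> u n t = x0 t by move=> t0; case: n => [|n]; rewrite /u /= t0.
have [x hx] : exists x : R -> 'cV[R]_d,
    forall t, exists n, forall m, (n <= m)%N -> u m t = x t.
  suff: forall t, exists y n, forall m, (n <= m)%N -> u m t = y.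
    by move=> /choice[x hx]; exists x.
  apply: (delay_ind htau) => [t t0|T delta d0 hd t /andP[t0 tT] IH].
    by exists (x0 t), 0%N => m _; exact: u0.
  have [|y [n hn]] := IH (t - tau t).
    by have := hd t; rewrite t0 ltW // => /(_ isT); lra.
  exists (A *m y), n.+1 => -[//|m] nm.
  by rewrite uS // hn.
exists x; split=> t t0; first by have [n hn] := hx t; rewrite -(hn n) // u0.
have [n hn] := hx t; have [m hm] := hx (t - tau t).
(* One unfolding costs one unit of fuel: the index [(maxn n m).+1] is stable at [t], and its
   predecessor at [t - tau t]. *)
by rewrite -(hn (maxn n m).+1) ?uS ?hm // ?leq_maxr // ltnW // ltnS leq_maxl.
Qed.

(** * Lateral limits of composite functions *)

Lemma cvg_at_right_of (R : realType) (T : Type) (F : set_system T) (FF : Filter F)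
    (g : T -> R) (l : R) :
  g @ F --> l -> (\forall t \near F, l < g t) -> g @ F --> l^'+.
Proof.
move=> gl lg A /= lA; have := gl _ lA.
by rewrite /= /nbhs /=; apply: filterS2 lg => t lt /(_ lt).
Qed.

Lemma cvg_at_left_of (R : realType) (T : Type) (F : set_system T) (FF : Filter F)
    (g : T -> R) (l : R) :
  g @ F --> l -> (\forall t \near F, g t < l) -> g @ F --> l^'-.
Proof.
move=> gl lg A /= lA; have := gl _ lA.
by rewrite /= /nbhs /=; apply: filterS2 lg => t lt /(_ lt).
Qed.

Lemma near_eq_is_cvg (R : realType) (T : Type) (F : set_system T) (FF : Filter F)
    (f g : T -> R) :
  (\forall t \near F, f t = g t) -> cvg (g @ F) -> cvg (f @ F).
Proof.
move=> fg /cvg_ex[l gl]; apply/cvg_ex; exists l.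
by apply: cvg_trans gl; apply: near_eq_cvg; apply: filterS fg.
Qed.

(** Only lateral limits of [f] at [l] are available, and they may differ from each other and from
    [f l]. One-sidedness of [g] selects a single one of these three values. *)
Lemma is_cvg_comp_one_sided (R : realType) (F : set_system R)
    (FF : ProperFilter F) (K J : set R) (f g : R -> R) (l : R) :
  F J -> (forall t, J t -> K (g t)) -> g @ F --> l -> one_sided_on g l J ->
  regulated_at K f l -> cvg (f (g t) @[t --> F]).
Proof.
move=> FJ JK gl gJ [fr fl]; have [s Js] := filter_ex FJ.
case: gJ => gJ.
- have /cvg_ex[z fz] : cvg (f t @[t --> l^'+]).
    (* The value [g s] is itself a point of [K] to the right of [l]. *)
    by apply: fr; exists (g s); [exact: JK | exact: gJ].
  apply/cvg_ex; exists z; apply: (cvg_comp g f _ fz).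
  by apply: cvg_at_right_of => //; apply: filterS FJ.
- apply: (@near_eq_is_cvg _ _ _ _ _ (fun=> f l)); last exact: is_cvg_cst.
  by apply: filterS FJ => t /gJ ->.
- have /cvg_ex[z fz] : cvg (f t @[t --> l^'-]).
    by apply: fl; exists (g s); [exact: JK | exact: gJ].
  apply/cvg_ex; exists z; apply: (cvg_comp g f _ fz).
  by apply: cvg_at_left_of => //; apply: filterS FJ.
Qed.

Lemma is_cvg_mulmx_coord (R : realType) (d : nat) (A : 'M[R]_d) (T : Type)
    (F : set_system T) (FF : Filter F) (y : T -> 'cV[R]_d) (i : 'I_d) :
  (forall j, cvg (y t j 0 @[t --> F])) -> cvg ((A *m y t) i 0 @[t --> F]).
Proof.
move=> hy; have -> : (fun t => (A *m y t) i 0) =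
    (fun t => \sum_j (A i j * y t j 0)) by apply/funext => t; rewrite mxE.
apply/cvg_ex; exists (\sum_j A i j * lim (y t j 0 @[t --> F])).
apply: cvg_big => [|j _]; first exact: add_continuous.
by apply: cvgM; [exact: cvg_cst | exact: hy].
Qed.

(** Serves to keep the lateral limits of [t - tau t] in the domain of the solution, whose left end
    may be infinite. *)
Lemma lower_bound_cvg (R : realType) (F : set_system R) (FF : ProperFilter F)
    (a : \bar R) (g : R -> R) (l : R) :
  g @ F --> l -> (\forall t \near F, (a <= (g t)%:E)%E) -> (a <= l%:E)%E.
Proof.
case: a => [r| |] gl ag; last by rewrite leNye.
- by rewrite lee_fin; apply: (ler_cvg_to (cvg_cst r) gl).
- by have [s] := filter_ex ag; rewrite leye_eq.
Qed.

(** * The largest delay and the domain of the solution *)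

Lemma oppe_largest_delay0 (R : realType) (tau : R -> R) :
  (- largest_delay tau 0)%E = ereal_inf [set (s - tau s)%:E | s in `[0, +oo[].
Proof. by rewrite /largest_delay sub0e oppeK. Qed.

Lemma oppe_largest_delay_le (R : realType) (tau : R -> R) (s : R) :
  0 <= s -> (- largest_delay tau 0 <= (s - tau s)%:E)%E.
Proof.
move=> s0; rewrite oppe_largest_delay0; apply: ereal_inf_lbound.
by exists s => //=; rewrite in_itv /= s0.
Qed.

Lemma bar_itv_oyE (R : realType) (a : \bar R) :
  bar_itv_o a +oo%E = [set x : R | (a <= x%:E)%E].
Proof. by apply/seteqP; split=> x /=; [case|move=> ?; split=> //; rewrite ltry]. Qed.

(** The number [t - largest_delay tau t] is an infimum over [[t, +oo[], hence at least the infimum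
    over [[0, +oo[]. *)
Lemma largest_delay_history (R : realType) (tau : R -> R) (t s : R) :
  0 <= t -> (- largest_delay tau t <= s%:E)%E ->
  (- largest_delay tau 0 <= (t + s)%:E)%E.
Proof.
move=> t0; rewrite oppe_largest_delay0 /largest_delay addeC.
rewrite fin_num_oppeD // oppeK leeBlDr // -EFinD [s + t]addrC; apply: le_trans.
apply: ereal_inf_le_tmp => _ [u /= + <-]; rewrite !in_itv /= !andbT => tu.
by exists u => //=; rewrite in_itv /= (le_trans t0).
Qed.

(** * Regularity of the solution and of its histories, and the conclusion *)

Lemma regulated_delay_solution (R : realType) (d : nat) (A : 'M[R]_d)
    (tau : R -> R) (x0 x : R -> 'cV[R]_d) :
  positive_on_bounded tau ->
  well_regulated `[0, +oo[ (fun t => t - tau t) ->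
  regulatedv (bar_itv_c (- largest_delay tau 0)%E 0) x0 ->
  (forall t, t <= 0 -> x t = x0 t) ->
  (forall t, 0 <= t -> x t = A *m x (t - tau t)) ->
  regulatedv (bar_itv_o (- largest_delay tau 0)%E +oo%E) x.
Proof.
move=> htau [sreg sr sl] rx0 xx0 xE i t0; rewrite bar_itv_oyE.
set K := [set u | _]; rewrite -/(regulated_at K (fun t => x t i 0) t0) => Kt0.
(* All coordinates are treated together, since coordinate [i] of [A *m x (t - tau t)] involves every
   coordinate of [x]. *)
move: t0 Kt0 i; have Kup u v : K u -> u <= v -> K v.
  by rewrite /K /= => /le_trans h uv; apply: h; rewrite lee_fin.
have left_le0 t i : K t -> t <= 0 -> has_left K t ->
    cvg (x t' i 0 @[t' --> t^'-]).
  move=> Kt t0 [s Ks st].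
  have [_ h] := rx0 i t (conj Kt t0).
  apply: near_eq_is_cvg (h _); last by exists s => //; split=> //; lra.
  by near=> u; rewrite xx0 // (le_trans _ t0)// ltW.
(* [F] stands for either of the lateral neighborhoods of [t]. *)
have step (F : set_system R) T delta t (J : set R) :
    ProperFilter F -> F J -> F --> t ->
    cvg ((fun s => s - tau s) @ F) ->
    one_sided_on (fun s => s - tau s) (lim ((fun s => s - tau s) @ F)) J ->
    (forall s, J s -> 0 <= s) -> t < T ->
    (forall s, 0 <= s <= T -> delta <= tau s) ->
    (forall s, s <= t - delta -> K s -> forall i,
      regulated_at K (fun t => x t i 0) s) ->
    forall i, cvg (x t' i 0 @[t' --> F]).
  move=> FF FJ Ft cs oneJ J0 tT hd IH i; set l := lim _ in oneJ.
  have Kl : K l.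
    apply: (lower_bound_cvg _ cs).
    by apply: filterS FJ => s /J0; exact: oppe_largest_delay_le.
  (* Limit of [s - tau s <= s - delta]; since [t < T], the bound on [tau] also holds slightly to the
     right of [t]. *)
  have lt : l <= t - delta.
    apply: (ler_cvg_to cs (cvgB Ft (cvg_cst delta))).
    have FT : \forall s \near F, s < T by exact: (@cvgr_lt _ _ F FF idfun t Ft).
    near=> s; rewrite lerB // hd //; apply/andP; split.
      by apply: J0; near: s.
    by apply: ltW; near: s.
  apply: (@near_eq_is_cvg _ _ _ _ _ (fun s => (A *m x (s - tau s)) i 0)).
    by apply: filterS FJ => s /J0 /xE ->.
  apply: is_cvg_mulmx_coord => j.
  apply: (@is_cvg_comp_one_sided _ _ _ K J (fun s => x s j 0) _ l) => //.
    by move=> s /J0; exact: oppe_largest_delay_le.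
  exact: IH.
apply: (delay_ind htau) => [t t0 Kt i|T delta d0 hd t /andP[t0 tT] IH Kt i].
  split; last by apply: left_le0 => //; exact: ltW.
  move=> _; have [h _] := rx0 i t (conj Kt (ltW t0)).
  apply: near_eq_is_cvg (h _).
    near=> u; rewrite xx0 //; near: u.
    by apply: nbhs_right_le.
  by exists 0 => //; split=> //; exact: Kup Kt (ltW t0).
split.
  move=> _; have It : `[0, +oo[%classic t by rewrite /= in_itv /= t0.
  have Rt : has_right `[0, +oo[ t.
    by exists (t + 1); [rewrite /= in_itv /= andbT; lra | lra].
  have [e e0 [_ oneJ]] := sr t It Rt.
  apply: (step _ T delta t _ _ _ _ _ oneJ _ tT hd IH).
  - near=> u; rewrite /= in_itv /=; apply/andP; split; near: u.
      exact: nbhs_right_gt.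
    by apply: nbhs_right_lt; lra.
  - exact: cvg_at_right_filter cvg_id.
  - exact: (sreg t It).1.
  - by move=> s /=; rewrite in_itv /=; lra.
(* At time 0 the left limit comes from [x0], whereas the right limit came from the equation. *)
have [t1|t1] := leP t 0; first exact: left_le0.
move=> _; have It : `[0, +oo[%classic t by rewrite /= in_itv /= t0.
have Lt : has_left `[0, +oo[ t by exists 0 => //=; rewrite in_itv /= lexx.
(* The inclusion [JI] keeps the left neighborhood in nonnegative times, where the equation
   applies. *)
have [e e0 [JI oneJ]] := sl t It Lt.
apply: (step _ T delta t _ _ _ _ _ oneJ _ tT hd IH).
- near=> u; rewrite /= in_itv /=; apply/andP; split; near: u.
    by apply: nbhs_left_gt; lra.
  exact: nbhs_left_lt.
- exact: cvg_at_left_filter cvg_id.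
- exact: (sreg t It).2.
- by move=> s /JI /=; rewrite in_itv /= andbT.
Unshelve. all: by end_near. Qed.

(** A translation is strictly increasing, hence one-sided at every point, so the composition lemma
    applies. *)
Lemma regulatedv_history (R : realType) (d : nat) (tau : R -> R)
    (x : R -> 'cV[R]_d) (t : R) : 0 <= t ->
  regulatedv (bar_itv_o (- largest_delay tau 0)%E +oo%E) x ->
  regulatedv (bar_itv_c (- largest_delay tau t)%E 0) (history x t).
Proof.
move=> t0 rx i s [hs s0].
have Ks : bar_itv_o (- largest_delay tau 0)%E +oo%E (t + s).
  by rewrite bar_itv_oyE; exact: largest_delay_history.
split=> -[r [hr r0] rs].
  apply: (@is_cvg_comp_one_sided _ _ _ _ `]s, +oo[ (fun u => x u i 0)
    (fun u => t + u) (t + s) _ _ _ _ (rx i _ Ks)).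
  - by near=> u; rewrite /= in_itv /= andbT; near: u; exact: nbhs_right_gt.
  - move=> u /=; rewrite in_itv /= andbT bar_itv_oyE => su.
    apply: largest_delay_history => //.
    by apply: le_trans hs _; rewrite lee_fin ltW.
  - by apply: cvgD; [exact: cvg_cst | exact: cvg_at_right_filter cvg_id].
  - by apply: Or31 => u /=; rewrite in_itv /= andbT ltrD2l.
(* The neighborhood stops at [r], a point of the domain, so that the translated points do not leave
   the domain on the left. *)
apply: (@is_cvg_comp_one_sided _ _ _ _ `]r, s[ (fun u => x u i 0)
  (fun u => t + u) (t + s) _ _ _ _ (rx i _ Ks)).
- near=> u; rewrite /= in_itv /=; apply/andP; split; near: u.
    exact: nbhs_left_gt.
  exact: nbhs_left_lt.
- move=> u /=; rewrite in_itv /= bar_itv_oyE => /andP[ru _].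
  apply: largest_delay_history => //.
  by apply: le_trans hr _; rewrite lee_fin ltW.
- by apply: cvgD; [exact: cvg_cst | exact: cvg_at_left_filter cvg_id].
- by apply: Or33 => u /=; rewrite in_itv /= ltrD2l => /andP[].
Unshelve. all: by end_near. Qed.

Theorem theorem4p19 (R : realType) (d : nat) (hd : (0 < d)%N) (A : 'M[R]_d)
    (tau : R -> R) (htau : delay_function tau)
    (hinf : forall t : R, 0 <= t -> 0 < inf [set tau s | s in `[0, t]])
    (hsigma : well_regulated `[0, +oo[ (fun t => t - tau t))
    (x0 : R -> 'cV[R]_d) (hx0 : GG A tau 0 x0) :
  exists x : R -> 'cV[R]_d,
    [/\ regulated_solution A tau x,
        has_initial_condition tau x x0,
        (forall y : R -> 'cV[R]_d,
           regulated_solution A tau y -> has_initial_condition tau y x0 ->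
           forall t, bar_itv_o (- largest_delay tau 0)%E +oo%E t -> y t = x t)
      & forall t : R, 0 <= t -> GG A tau t (history x t)].
Proof.
have ptau := inf_positive_on_bounded htau hinf.
have [rx0 x00] := hx0.
have [x [xx0 xE]] := delay_solution_exists A x0 ptau.
(* The construction gives [x 0] by the equation; the compatibility condition in [GG] identifies it
   with [x0 0]. *)
have xx0' t : t <= 0 -> x t = x0 t.
  rewrite le_eqVlt => /predU1P[->|]; last exact: xx0.
  by rewrite xE // sub0r xx0 ?x00 // oppr_lt0 htau.
have rx := regulated_delay_solution ptau hsigma rx0 xx0' xE.
exists x; split.
- by split.
- by move=> t [_ /xx0'].
(* Uniqueness: two solutions agree at negative times of the domain, and agreement at [t - tau t]
   passes to [t] through the equation. *)
- move=> y [_ yE] yx0; apply: (delay_ind ptau) => [t t0|].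
    by rewrite bar_itv_oyE => Kt; rewrite xx0 // yx0 //; split=> //; exact: ltW.
  move=> T delta _ hdelta t /andP[t0 tT] IH Kt.
  rewrite yE // xE // IH //.
    by rewrite lerB // hdelta // t0 ltW.
  by rewrite bar_itv_oyE; exact: oppe_largest_delay_le.
- move=> t t0; split; first exact: regulatedv_history.
  by rewrite /history addr0 xE.
Qed.
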